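(* Let $H$ be a real Hilbert space, $A$ a bounded linear operator in $H$ defined on all of $H$ whose range is not closed (so that $Au=f$ is an ill-posed problem), $N$ the null-space of $A$, and let $f\in H$ be such that there is $y\in H$ with $Ay=f$, $y\perp N$. Let $B:=A^*A$, $q:=A^*f$. Assume $\epsilon(t)>0$ is a continuous function on $[0,\infty)$ decaying monotonically to zero. Then, for any $u_0\in H$, the problem $$\dot u=-u+(B+\epsilon(t))^{-1}q,\qquad u(0)=u_0,$$ has a unique global solution $u(t)$, the limit $u(\infty):=\lim_{t\to\infty}u(t)$ exists, $u(\infty)=y$, $Ay=f$, and $y$ is the minimal-norm solution to $Au=f$. If $f_\delta$ is given in place of $f$, $\|f-f_\delta\|\le\delta$, then $$\lim_{\delta\to0}\|u_\delta(t_\delta)-y\|=0,$$ where $u_\delta(t)$ solves $\dot u_\delta=-u_\delta+(B+\epsilon(t))^{-1}q_\delta$, $u_\delta(0)=u_0$, with $q_\delta:=A^*f_\delta$, and $t_\delta$ is chosen, for example, as the root of the equation $2\sqrt{\epsilon(t)}=\delta^b$, $b\in(0,1)$ (or by a discrepancy principle).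
   Context: $A^*$ is the adjoint of $A$; $B+\epsilon(t)$ means $B+\epsilon(t)I$ with $I$ the identity; $\dot u=du/dt$; a global solution is one defined for all $t\ge0$. Choosing $t_\delta$ by a discrepancy principle is an a posteriori choice of the stopping time; the paper does not specify it further. *)

(* Defs.v *)
From HB Require Import structures.
From mathcomp Require Import all_boot all_order all_algebra sesquilinear.
From mathcomp Require Import all_classical all_reals all_analysis.
Import Order.TTheory GRing.Theory Num.Theory.
Import numFieldNormedType.Exports.

Set Implicit Arguments.
Unset Strict Implicit.
Unset Printing Implicit Defensive.

Local Open Scope classical_set_scope.
Local Open Scope ring_scope.

(* A real Hilbert space is a complete normed module [H] with a positive
   definite symmetric form [dot] such that [dot x x = `|x| ^+ 2]; this last
   equation is a hypothesis wherever it is needed. *)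
Section Operators.
Context {R : realType} {H : completeNormedModType R} (dot : {dot H for idfun}).

Definition bounded_operator (A : H -> H) : Prop :=
  exists M : R, forall x, `|A x| <= M * `|x|.

(* [adjoint A y] is the z such that <A x, y> = <x, z> for all x; the default
   value 0 is only used when no such z exists, which does not happen for a
   bounded linear [A]. *)
Definition adjoint (A : H -> H) (y : H) : H :=
  xget 0 [set z | forall x, dot (A x) y = dot x z].

Definition minimal_norm_solution (A : H -> H) (f y : H) : Prop :=
  A y = f /\ forall z, A z = f -> z <> y -> `|y| < `|z|.

(* [shift_inv B e] is (B + e I)^-1. *)
Definition shift_inv (B : H -> H) (e : R) : H -> H :=
  'pinv_(fun=> 0) setT (fun x => B x + e *: x).

(* (B + e I)^-1 A^* g with B = A^* A *)
Definition regularized (A : H -> H) (e : R) (g : H) : H :=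
  shift_inv (adjoint A \o A) e (adjoint A g).

(* [u] solves u' = - u + (B + eps(t))^-1 A^* g on [0, +oo[ with u(0) = u0, the
   derivative at 0 being one-sided; the values of [u] on ]-oo, 0[ are
   irrelevant. *)
Definition global_solution (A : H -> H) (eps : R -> R) (g u0 : H)
    (u : R -> H) : Prop :=
  let F (t : R) : H := - u t + regularized A (eps t) g in
  [/\ u 0 = u0,
      h^-1 *: (u h - u 0) @[h --> 0^'+] --> F 0 &
      forall t : R, 0 < t -> is_derive t 1 u (F t)].

Definition unique_global_solution (A : H -> H) (eps : R -> R) (g u0 : H)
    (u : R -> H) : Prop :=
  global_solution A eps g u0 u /\
  forall v, global_solution A eps g u0 v -> forall t, 0 <= t -> v t = u t.

Definition a_priori_time (eps : R -> R) (b d t : R) : Prop :=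
  0 <= t /\ 2 * Num.sqrt (eps t) = d `^ b.

(* Morozov's discrepancy principle for the regularized solution
   (B + eps(t))^-1 A^* g of the equation with data [g] and noise level [d]. *)
Definition discrepancy_time (A : H -> H) (eps : R -> R) (C : R) (g : H)
    (d t : R) : Prop :=
  0 <= t /\ `|A (regularized A (eps t) g) - g| = C * d.

End Operators.

(* Main.v *)
Require Import Defs.
From HB Require Import structures.
From mathcomp Require Import all_boot all_order all_algebra sesquilinear.
From mathcomp Require Import all_classical all_reals all_analysis.
From mathcomp Require Import ring lra.
Import Order.TTheory GRing.Theory Num.Theory.
Import numFieldNormedType.Exports.

Set Implicit Arguments.
Unset Strict Implicit.
Unset Printing Implicit Defensive.

Local Open Scope classical_set_scope.
Local Open Scope ring_scope.

(** Write T_e = A^* A + e I and w_e(g) = T_e^-1 A^* g, so that the equation is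
    u' = - u + w_(eps t)(g): the solution follows the Tikhonov regularization
    of parameter eps t.

    Existence of A^* and of T_e^-1: projections onto subspaces give the Riesz
    theorem, and also the surjectivity of symmetric coercive maps, whose range
    is at once dense and complete [symmetric_coercive_surj].

    Bias: r_e = y - w_e(f) satisfies T_e r_e = e y.  Since y is orthogonal to
    the kernel of A it is a limit of vectors A^* h, and for y = A^* h one has
    r_e = e w_e(h), of norm at most sqrt(e) |h|; hence w_e(f) tends to y as e
    tends to 0 [regularized_cvg].

    Dynamics: a solution of z' = - z + p with |p| <= K on ]a, b[ satisfies
    |z b| <= K + exp(a - b) |z a| [decay_bound].  Applied to differences, this
    yields uniqueness, the convergence of u to y (the right-hand side w tends
    to y) and, because |w_e(f) - w_e(fd)| <= d / sqrt e, the noise estimate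
    |ud t - u t| <= d / sqrt (eps t).

    Stopping times: it is therefore enough that eps (td d) -> 0 and
    d / sqrt (eps (td d)) -> 0 [stopping_cvg].  For the a priori choice the
    quotient equals 2 d^(1 - b).  For the discrepancy principle, the residual of
    the noisy problem is at most d more than that of the exact one, so that
    (C - 1) d <= |A r_e|; the energy identity for r_e gives
    |A r_e|^2 <= e |y| |r_e|, and r_e -> 0 [discrepancy_stopping].  When f = 0
    the discrepancy equation has no solution at all. *)

(** * Elementary geometry of the inner product *)

Section Hilbert.
Context {R : realType} {H : completeNormedModType R} (dot : {dot H for idfun}).
Context (dot_norm : forall x : H, dot x x = `|x| ^+ 2).

Lemma dotC x z : dot x z = dot z x.
Proof. by rewrite hermC expr0 mul1r. Qed.

Lemma dotDl x1 x2 z : dot (x1 + x2) z = dot x1 z + dot x2 z.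
Proof. exact: linearDl. Qed.

Lemma dotDr z x1 x2 : dot z (x1 + x2) = dot z x1 + dot z x2.
Proof. exact: linearDr. Qed.

Lemma dotNl x z : dot (- x) z = - dot x z.
Proof. exact: linearNl. Qed.

Lemma dotNr z x : dot z (- x) = - dot z x.
Proof. exact: linearNr. Qed.

Lemma dotZl a x z : dot (a *: x) z = a * dot x z.
Proof. exact: linearZl_LR. Qed.

Lemma dotZr a z x : dot z (a *: x) = a * dot z x.
Proof. exact: linearZr_LR. Qed.

Lemma dot0l z : dot 0 z = 0.
Proof. exact: linear0l. Qed.

Lemma dot0r z : dot z 0 = 0.
Proof. exact: linear0r. Qed.

Definition dotE := (dotDl, dotDr, dotNl, dotNr, dotZl, dotZr, dot0l, dot0r).

Lemma cauchy_schwarz (x z : H) : `|dot x z| <= `|x| * `|z|.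
Proof.
have [->|z0] := eqVneq z 0; first by rewrite dot0r !normr0 mulr0.
have z2 : 0 < `|z| ^+ 2 by rewrite exprn_gt0// normr_gt0.
rewrite -(@ler_pXn2r _ 2%N)// ?nnegrE ?mulr_ge0// real_normK ?num_real//.
have : 0 <= dot (`|z| ^+ 2 *: x - dot x z *: z) (`|z| ^+ 2 *: x - dot x z *: z).
  by rewrite dot_norm exprn_ge0.
rewrite !dotE !dot_norm (dotC z x) exprMn => h.
have {h} : 0 <= `|z| ^+ 2 * (`|x| ^+ 2 * `|z| ^+ 2 - dot x z ^+ 2).
  by apply: le_trans h _; rewrite le_eqVlt; apply/orP; left; apply/eqP; ring.
by rewrite pmulr_rge0// subr_ge0.
Qed.

Lemma dot_le (x z : H) : dot x z <= `|x| * `|z|.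
Proof. exact: le_trans (ler_norm _) (cauchy_schwarz x z). Qed.

(** Turns identities between operators into scalar ones, where adjoints can be
    moved across the inner product. *)
Lemma dot_sep (x z : H) : (forall c, dot x c = dot z c) -> x = z.
Proof.
move=> xz; apply/eqP; rewrite -subr_eq0 -normr_eq0 -sqrf_eq0 -dot_norm.
by rewrite dotDl dotNl xz subrr.
Qed.

Lemma cvg_dotr (T : Type) (F : set_system T) (FF : Filter F) (g : T -> H) l c :
  g @ F --> l -> dot (g x) c @[x --> F] --> dot l c.
Proof.
move=> gl; apply/cvgrPdist_le => e e0.
have c1 : 0 < `|c| + 1 by rewrite ltr_wpDl.
move/cvgrPdist_le: gl => /(_ (e / (`|c| + 1))) gl.
near=> x; rewrite -dotNl -dotDl.
apply: le_trans (cauchy_schwarz _ _) _.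
have : `|l - g x| <= e / (`|c| + 1) by near: x; apply: gl; rewrite divr_gt0.
rewrite ler_pdivlMr// mulrDr mulr1; apply: le_trans.
by rewrite lerDl.
Unshelve. all: by end_near. Qed.

Lemma parallelogram (x z : H) :
  `|x + z| ^+ 2 + `|x - z| ^+ 2 = 2 * (`|x| ^+ 2 + `|z| ^+ 2).
Proof. by rewrite -!dot_norm !dotE (dotC z x); ring. Qed.

End Hilbert.

(** * Orthogonal projection and Riesz representation *)

Section Projection.
Context {R : realType} {H : completeNormedModType R} (dot : {dot H for idfun}).
Context (dot_norm : forall x : H, dot x x = `|x| ^+ 2).

(** A minimizing sequence for the distance from x to S is Cauchy by the
    parallelogram law.  The limit p lies in the closure of S, hence the
    sequence in the conclusion. *)
Lemma subspace_projection (S : set H) (S0 : S 0)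
    (SP : forall a x z, S x -> S z -> S (a *: x + z)) (x : H) :
  exists (s : nat -> H) (p : H), [/\ forall n, S (s n),
    s n @[n --> \oo] --> p & forall z, S z -> dot (x - p) z = 0].
Proof.
pose D := [set `|x - z| ^+ 2 | z in S].
have Dlb : has_inf D.
  split; first by exists (`|x - 0| ^+ 2), 0.
  by exists 0 => _ [z _ <-]; exact: exprn_ge0.
pose i := inf D.
have iS z : S z -> i <= `|x - z| ^+ 2.
  by move=> Sz; apply: ge_inf; [exact: Dlb.2|exists z].
have /choice[s sP] n : exists z, S z /\ `|x - z| ^+ 2 <= i + harmonic n.
  have [_ [z Sz <-] /ltW zi] :=
    @inf_adherent _ D (harmonic n) (harmonic_gt0 n) Dlb.
  by exists z.
have sS n : S (s n) := (sP n).1.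
have sD n m : `|s n - s m| ^+ 2 <= 2 * (harmonic n + harmonic m).
  have half : S (2^-1 *: s n + 2^-1 *: s m).
    by apply: (SP _ _ _ (sS n)); rewrite -[X in S X]addr0; exact: SP.
  have := parallelogram dot_norm (x - s n) (x - s m).
  have -> : x - s n - (x - s m) = - (s n - s m).
    by rewrite !opprB addrC subrKA.
  rewrite normrN.
  have -> : x - s n + (x - s m) = 2 *: (x - (2^-1 *: s n + 2^-1 *: s m)).
    rewrite scalerBr scalerDr !scalerA divff ?pnatr_eq0// !scale1r.
    by rewrite scaler_nat mulr2n opprD addrACA.
  rewrite normrZ exprMn ger0_norm//; have := iS _ half.
  have := (sP n).2; have := (sP m).2; lra.
have scv : cvg (s n @[n --> \oo]).
  apply/cauchy_cvgP/cauchy_exP => e e0.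
  have e1 : 0 < e ^+ 2 / 4 by rewrite divr_gt0// exprn_gt0.
  have [N _ NP] : \forall n \near \oo, @harmonic R n < e ^+ 2 / 4.
    exact: near_infty_natSinv_lt (PosNum e1).
  exists (s N), N => // n /= Nn; rewrite -ball_normE /ball_/=.
  rewrite -(@ltr_pXn2r _ 2%N)// ?nnegrE ?(ltW e0)//.
  apply: le_lt_trans (sD _ _) _.
  have := NP n Nn; have := NP N (leqnn N); lra.
exists s, (lim (s n @[n --> \oo])); split => // z Sz.
set p := lim _; set c := dot (x - p) z.
(* Minimality of p in the direction z: |x - p|^2 <= |x - p - a z|^2. *)
have quad a : 2 * a * c <= a ^+ 2 * `|z| ^+ 2.
  have cvg1 : 2 * a * dot (x - s n) z @[n --> \oo] --> 2 * a * c.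
    apply: cvgM; first exact: cvg_cst.
    apply: cvg_dotr => //; apply: cvgB => //; exact: cvg_cst.
  have cvg2 : harmonic n + a ^+ 2 * `|z| ^+ 2 @[n --> \oo] -->
      a ^+ 2 * `|z| ^+ 2.
    rewrite -[X in _ --> X]add0r; apply: cvgD; last exact: cvg_cst.
    exact: cvg_harmonic.
  apply: (ler_cvg_to cvg1 cvg2); apply: nearW => n.
  have := iS (s n + a *: z); rewrite addrC => /(_ (SP _ _ _ Sz (sS n))).
  have := (sP n).2; rewrite -!dot_norm !dotE (dotC dot z x) (dotC dot z (s n)).
  lra.
have [->|c0] := eqVneq c 0; first by [].
have k0 : 0 < `|z| ^+ 2 + 1 by rewrite ltr_wpDl// exprn_ge0.
(* The choice a = c / (|z|^2 + 1) contradicts quad unless c = 0; adding 1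
   avoids the case z = 0. *)
have := quad (c / (`|z| ^+ 2 + 1)); set a := c / _.
have cE : c = a * (`|z| ^+ 2 + 1) by rewrite divfK// gt_eqF.
have : 0 < a ^+ 2 * (`|z| ^+ 2 + 2).
  rewrite mulr_gt0// ?ltr_wpDl// ?exprn_ge0// exprn_even_gt0//=.
  by apply: contra_neq c0 => a0; rewrite cE a0 mul0r.
rewrite cE; lra.
Qed.

(* Riesz *)
(** For x off the kernel of l, the component q of x orthogonal to the kernel
    spans the orthogonal complement of the kernel. *)
Lemma riesz (l : H -> R) (M : R)
    (lP : forall a x z, l (a *: x + z) = a * l x + l z)
    (lM : forall x, `|l x| <= M * `|x|) :
  exists g, forall x, l x = dot x g.
Proof.
have l0 : l 0 = 0.
  by apply/eqP; rewrite -normr_le0; have := lM 0; rewrite normr0 mulr0.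
have lZ a x : l (a *: x) = a * l x by rewrite -[a *: x]addr0 lP l0 addr0.
have [[x lx]|/forallNP lx0] := pselect (exists x, l x <> 0); last first.
  by exists 0 => x; rewrite dot0r; apply: contra_notP (lx0 x).
have [|a u v /= lu lv|s [p [sl sp ort]]] :=
  @subspace_projection [set x | l x = 0] _ _ x.
- exact: l0.
- by rewrite lP lu lv mulr0 addr0.
have lp : l p = 0.
  have : (fun n => `|l (p - s n)|) @ \oo --> `|l p|.
    suff -> : (fun n => `|l (p - s n)|) = cst `|l p| by exact: cvg_cst.
    by apply/funext => n; rewrite -[p - _]addrC -scaleN1r lP sl mulr0 add0r.
  move=> cv1.
  have cv2 : M * `|p - s n| @[n --> \oo] --> M * `|p - p|.
    apply: cvgM; first exact: cvg_cst.
    by apply: cvg_norm; apply: cvgB => //; exact: cvg_cst.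
  apply/eqP; rewrite -normr_le0; apply: le_trans (ler_cvg_to cv1 cv2 _) _.
    exact: nearW.
  by rewrite subrr normr0 mulr0.
pose q := x - p; rewrite -/q in ort.
have lq : l q = l x by rewrite /q addrC -scaleN1r lP lp mulr0 add0r.
clearbody q.
have q0 : `|q| ^+ 2 != 0.
  rewrite sqrf_eq0 normr_eq0; apply/eqP => q0; apply: lx.
  by rewrite -lq q0.
exists ((l q / `|q| ^+ 2) *: q) => z.
have : dot q (- (l z / l q) *: q + z) = 0.
  apply: ort => /=; rewrite lP mulNr divfK ?addNr// lq; exact/eqP.
rewrite !dotE dot_norm (dotC dot q z) => zq.
have -> : dot z q = l z / l q * `|q| ^+ 2 by lra.
by field; rewrite -(sqrf_eq0 `|q|) q0 andbT lq; exact/eqP.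
Qed.

End Projection.

(** * Symmetric coercive operators *)

Section Coercive.
Context {R : realType} {H : completeNormedModType R} (dot : {dot H for idfun}).
Context (dot_norm : forall x : H, dot x x = `|x| ^+ 2).

Lemma coercive_expand (T : H -> H) (e : R) (x : H) : 0 < e ->
  e * `|x| ^+ 2 <= dot (T x) x -> e * `|x| <= `|T x|.
Proof.
move=> e0 coer; have [->|x0] := eqVneq x 0; first by rewrite normr0 mulr0.
have x1 : 0 < `|x| by rewrite normr_gt0.
rewrite -(ler_pM2r x1) -mulrA -expr2; apply: le_trans coer _.
exact: dot_le.
Qed.

(** Coercivity makes preimages of a convergent sequence Cauchy, so that the
    range of T is closed, and by symmetry a vector v orthogonal to that range
    satisfies <T v, v> = <v, T v> = 0, hence v = 0.  Symmetry also identifies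
    the limit of the T (x n), through their inner products. *)
Lemma symmetric_coercive_surj (T : H -> H) (e : R) :
  (forall a x z, T (a *: x + z) = a *: T x + T z) ->
  (forall x z, dot (T x) z = dot x (T z)) ->
  0 < e -> (forall x, e * `|x| ^+ 2 <= dot (T x) x) ->
  forall g, exists x, T x = g.
Proof.
move=> TP Tsym e0 coer g.
have T0 : T 0 = 0.
  have := TP (-1) 0 0; rewrite scaleN1r oppr0 addr0.
  by rewrite scaleN1r addNr.
have TB x z : T (x - z) = T x - T z.
  by rewrite [x - z]addrC -scaleN1r TP scaleN1r addrC.
have [||s [p [sS sp ort]]] := subspace_projection dot_norm (S := range T) _ _ g.
- by exists 0.
- by move=> a _ _ [x _ <-] [z _ <-]; exists (a *: x + z).
have /choice[x xs] n : exists x, T x = s n by have [x _] := sS n; exists x.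
have xcv : cvg (x n @[n --> \oo]).
  apply/cauchy_cvgP/cauchy_exP => d d0.
  have ed : 0 < e * d / 2 by rewrite divr_gt0// mulr_gt0.
  have [N _ NP] := (cvgrPdist_lt _ _).1 sp _ ed.
  exists (x N), N => // n /= Nn; rewrite -ball_normE /ball_/= -(ltr_pM2l e0).
  apply: le_lt_trans (coercive_expand e0 (coer _)) _.
  rewrite TB !xs [e * d]splitr; apply: le_lt_trans (ler_distD p _ _) _.
  by apply: ltrD; [rewrite distrC; exact: (NP N (leqnn N))|exact: NP].
exists (lim (x n @[n --> \oo])).
have -> : T (lim (x n @[n --> \oo])) = p.
  apply: (dot_sep dot_norm) => c; rewrite Tsym.
  apply: (@cvg_unique _ _ (dot (x n) (T c) @[n --> \oo])) => //.
    exact: cvg_dotr.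
  rewrite (_ : (fun n => _) = fun n => dot (s n) c); first exact: cvg_dotr.
  by apply/funext => n; rewrite -Tsym xs.
apply/eqP; rewrite eq_sym -subr_eq0 -normr_le0.
have : e * `|g - p| ^+ 2 <= 0.
  by apply: le_trans (coer _) _; rewrite Tsym ort//; exists (g - p).
by rewrite pmulr_rle0 => [h|//]; rewrite -(@ler_pXn2r _ 2%N)?nnegrE ?expr0n.
Unshelve. all: by end_near. Qed.

End Coercive.

(** * Tikhonov regularization *)

Section Tikhonov.
Context {R : realType} {H : completeNormedModType R} (dot : {dot H for idfun}).
Context (dot_norm : forall x : H, dot x x = `|x| ^+ 2).
Context (A : {linear H -> H}) (M : R) (M0 : 0 <= M).
Context (A_le : forall x, `|A x| <= M * `|x|).

Notation As := (adjoint dot A).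

(** Riesz shows that the default value of [adjoint] is not taken. *)
Lemma adjointP x z : dot (A x) z = dot x (As z).
Proof.
rewrite /adjoint; case: xgetP => [w _ wP|none]; first exact: wP.
have [||w wP] := @riesz _ _ dot dot_norm (fun u => dot (A u) z) (M * `|z|).
- by move=> a u v; rewrite linearP !dotE.
- by move=> u; apply: le_trans (cauchy_schwarz dot_norm _ _) _;
    rewrite mulrAC ler_wpM2r.
by have := none w.
Qed.

Lemma adjointPl x z : dot (As x) z = dot x (A z).
Proof. by rewrite (dotC dot) -adjointP (dotC dot). Qed.

Lemma adjoint_linear a x z : As (a *: x + z) = a *: As x + As z.
Proof.
by apply: (dot_sep dot_norm) => c; rewrite !dotE !adjointPl !dotE.
Qed.

Lemma adjointB x z : As (x - z) = As x - As z.
Proof. by rewrite [x - z]addrC -scaleN1r adjoint_linear scaleN1r addrC. Qed.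

Lemma adjoint_le z : `|As z| <= M * `|z|.
Proof.
have [->|x0] := eqVneq (As z) 0; first by rewrite normr0 mulr_ge0.
have x1 : 0 < `|As z| by rewrite normr_gt0.
rewrite -(ler_pM2r x1) -expr2 -dot_norm -adjointP.
by apply: le_trans (dot_le dot_norm _ _) _; rewrite mulrAC ler_wpM2r.
Qed.

Definition normal_op (e : R) (x : H) : H := As (A x) + e *: x.

Lemma normal_op_linear e a x z :
  normal_op e (a *: x + z) = a *: normal_op e x + normal_op e z.
Proof.
rewrite /normal_op linearP adjoint_linear !scalerDr !scalerA (mulrC e).
by rewrite addrACA.
Qed.

Lemma normal_opB e x z : normal_op e (x - z) = normal_op e x - normal_op e z.
Proof. by rewrite [x - z]addrC -scaleN1r normal_op_linear scaleN1r addrC. Qed.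

Lemma normal_opZ e a x : normal_op e (a *: x) = a *: normal_op e x.
Proof.
have s0 : normal_op e 0 = 0 by have := normal_opB e 0 0; rewrite !subrr.
by rewrite -[a *: x]addr0 normal_op_linear s0 addr0.
Qed.

Lemma normal_op_dot e x z :
  dot (normal_op e x) z = dot (A x) (A z) + e * dot x z.
Proof. by rewrite /normal_op !dotE adjointPl. Qed.

Lemma normal_op_coercive e x : e * `|x| ^+ 2 <= dot (normal_op e x) x.
Proof. by rewrite normal_op_dot !dot_norm lerDr exprn_ge0. Qed.

Lemma normal_op_expand e x : 0 < e -> e * `|x| <= `|normal_op e x|.
Proof. by move=> e0; apply: coercive_expand => //; exact: normal_op_coercive. Qed.

Lemma shift_invP e g : 0 < e -> normal_op e (shift_inv (As \o A) e g) = g.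
Proof.
move=> e0.
have [||x xg] := @symmetric_coercive_surj _ _ _ dot_norm (normal_op e) e _ _ e0
  (normal_op_coercive e) g.
- exact: normal_op_linear.
- by move=> x z; rewrite normal_op_dot [RHS](dotC dot) normal_op_dot (dotC dot (A z))
    (dotC dot z).
rewrite /shift_inv; apply: (@pinvK _ _ _ setT (normal_op e)).
by rewrite inE; exists x.
Qed.

(** The Euler equation of w |-> |A w - g|^2 + e |w|^2.  The estimates are
    stated for any solution of this equation, which makes them linear in
    (g, w): they apply to differences of regularized solutions. *)
Definition normal_eq (e : R) (g w : H) : Prop := normal_op e w = As g.

Lemma regularizedP e g : 0 < e -> normal_eq e g (regularized dot A e g).
Proof. exact: shift_invP. Qed.

Lemma normal_eqB e g w g' w' : normal_eq e g w -> normal_eq e g' w' ->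
  normal_eq e (g - g') (w - w').
Proof. by rewrite /normal_eq normal_opB adjointB => -> ->. Qed.

Lemma normal_eq_energy e g w : normal_eq e g w ->
  `|A w| ^+ 2 + e * `|w| ^+ 2 = dot g (A w).
Proof. by move=> E; rewrite -!dot_norm -normal_op_dot E adjointPl. Qed.

(** From the energy identity, e |w|^2 <= |g| |A w| - |A w|^2 <= |g|^2.  This is
    the bound sqrt(e)^-1 for the norm of T_e^-1 A^*. *)
Lemma normal_eq_norm e g w : 0 < e -> normal_eq e g w ->
  Num.sqrt e * `|w| <= `|g|.
Proof.
move=> e0 /normal_eq_energy E.
rewrite -(@ler_pXn2r _ 2%N)// ?nnegrE ?mulr_ge0 ?sqrtr_ge0//.
rewrite exprMn sqr_sqrtr ?(ltW e0)//.
have := dot_le dot_norm g (A w); rewrite -E.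
have := sqr_ge0 (`|g| - `|A w|); have := sqr_ge0 (`|A w|); rewrite sqrrB; nra.
Qed.

(** Compare the minimizer w of |A w - g|^2 + e |w|^2 with 0. *)
Lemma normal_eq_residual e g w : 0 < e -> normal_eq e g w ->
  `|A w - g| <= `|g|.
Proof.
move=> e0 /normal_eq_energy E.
rewrite -(@ler_pXn2r _ 2%N)// ?nnegrE// -!dot_norm !dotE !dot_norm (dotC dot (A w)).
rewrite -E.
have : 0 <= e * `|w| ^+ 2 by rewrite mulr_ge0 ?exprn_ge0// ltW.
have := sqr_ge0 (`|A w|); lra.
Qed.

(** A converse bound: the residual controls the data as long as e stays away
    from 0, because e w = A^* (g - A w).  It forces the parameter chosen by the
    discrepancy principle to tend to 0, and gives the starting value in the
    proof that the principle can be satisfied. *)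
Lemma normal_eq_residual_ge e g w : 0 < e -> normal_eq e g w ->
  `|g| <= (1 + M ^+ 2 / e) * `|A w - g|.
Proof.
move=> e0 E.
have ew : e *: w = As (g - A w) by rewrite adjointB -E /normal_op addrAC subrr add0r.
have h1 : e * `|w| <= M * `|A w - g|.
  rewrite -[e in e * _](gtr0_norm e0) -normrZ ew -opprB -[in leRHS]normrN opprB.
  exact: adjoint_le.
have h2 : `|A w| <= M ^+ 2 / e * `|A w - g|.
  apply: le_trans (A_le w) _; rewrite expr2 -!mulrA ler_wpM2l//.
  by rewrite mulrCA ler_pdivlMl.
have : `|g| <= `|A w| + `|A w - g|.
  by have := ler_normB (A w) (A w - g); rewrite subKr.
lra.
Qed.

(** The difference solves T_e (w - w') = (e' - e) w'; apply coercivity. *)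
Lemma normal_eq_lipschitz e e' g w w' : 0 < e -> normal_eq e g w ->
  normal_eq e' g w' -> e * `|w - w'| <= `|e - e'| * `|w'|.
Proof.
move=> e0 E E'.
apply: le_trans (normal_op_expand _ e0) _.
suff -> : normal_op e (w - w') = (e' - e) *: w' by rewrite normrZ distrC.
rewrite normal_opB E -E' /normal_op scalerBl opprD addrACA subrr add0r.
by [].
Qed.

Lemma regularized_continuous g e : 0 < e ->
  {for e, continuous (fun e => regularized dot A e g)}.
Proof.
move=> e0; set w := regularized dot A ^~ g; apply/cvgrPdist_le => d d0.
have K0 : 0 < `|w e| + 1 by rewrite ltr_wpDl.
have r0 : 0 < d * (e / 2) / (`|w e| + 1) by rewrite divr_gt0// mulr_gt0// divr_gt0.
near=> e'.
have e'e : `|e - e'| <= e / 2.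
  by near: e'; apply: cvgr_dist_le; [exact: cvg_id|rewrite divr_gt0].
have e2 : e / 2 <= e' by have := ler_norm (e - e'); lra.
have e'0 : 0 < e' by apply: lt_le_trans e2; rewrite divr_gt0.
have e'd : `|e - e'| <= d * (e / 2) / (`|w e| + 1).
  by near: e'; apply: cvgr_dist_le; [exact: cvg_id|].
have := normal_eq_lipschitz e'0 (regularizedP g e'0) (regularizedP g e0).
rewrite -/(w e) -/(w e') (distrC (w e')) (distrC e') => lip.
have : e' * `|w e - w e'| <= d * (e / 2).
  apply: le_trans lip _; move: e'd; rewrite ler_pdivlMr//; apply: le_trans.
  by rewrite mulrDr mulr1 lerDl.
move=> /le_trans h; rewrite -(ler_pM2l e'0); apply: h.
by rewrite mulrC ler_wpM2r// ltW.
Unshelve. all: by end_near. Qed.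

Section Bias.
Context (y : H) (y_perp : forall z, A z = 0 -> dot y z = 0).

(** If p is the projection of y on the closure of the range of A^*, then
    y - p is in the kernel of A, so it is orthogonal to y as well as to p. *)
Lemma adjoint_range_dense d : 0 < d -> exists h, `|y - As h| <= d.
Proof.
move=> d0.
have [||s [p [sS sp ort]]] := subspace_projection dot_norm (S := range As) _ _ y.
- by exists 0 => //; have := adjointB 0 0; rewrite !subrr.
- by move=> a _ _ [x _ <-] [z _ <-]; exists (a *: x + z) => //; rewrite adjoint_linear.
have Ayp : A (y - p) = 0.
  apply: (dot_sep dot_norm) => c.
  by rewrite dot0l adjointP ort//; exists c.
have py : dot p (y - p) = 0.
  apply: (@cvg_unique _ _ (dot (s n) (y - p) @[n --> \oo])) => //.
    exact: cvg_dotr.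
  suff -> : (fun n => dot (s n) (y - p)) = cst 0 by exact: cvg_cst.
  apply/funext => n; have [h _ <-] := sS n.
  by rewrite adjointPl Ayp dot0r.
have yp : y = p.
  apply/eqP; rewrite -subr_eq0 -normr_eq0 -sqrf_eq0 -dot_norm dotDl dotNl.
  by rewrite py (y_perp Ayp) subrr.
have [N _ NP] := (cvgrPdist_le _ _).1 sp _ d0.
have [h _ hs] := sS N.
by exists h; rewrite hs yp; exact: (NP N (leqnn N)).
Qed.

Lemma bias_eq e w : normal_eq e (A y) w -> normal_op e (y - w) = e *: y.
Proof. by rewrite normal_opB => ->; rewrite /normal_op addrC addKr. Qed.

(** Pair T_e (y - w) = e y with y - w. *)
Lemma bias_residual e w : normal_eq e (A y) w -> 0 < e ->
  `|A w - A y| ^+ 2 <= e * (`|y| * `|y - w|).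
Proof.
move=> /bias_eq E e0; rewrite distrC -linearB -dot_norm.
have := normal_op_dot e (y - w) (y - w); rewrite E dotZl => h.
have : 0 <= e * dot (y - w) (y - w) by rewrite dot_norm mulr_ge0 ?exprn_ge0// ltW.
have : e * dot y (y - w) <= e * (`|y| * `|y - w|).
  by rewrite ler_wpM2l ?(ltW e0)//; exact: dot_le.
by rewrite h; lra.
Qed.

(** Split T_e^-1 (e y) according to y = (y - A^* h) + A^* h: the first part is
    bounded by |y - A^* h| uniformly in e, the second by sqrt(e) |h|. *)
Lemma regularized_cvg :
  regularized dot A e (A y) @[e --> 0^'+] --> y.
Proof.
apply/cvgrPdist_le => d d0.
have d2 : 0 < d / 2 by rewrite divr_gt0.
have [h hd] := adjoint_range_dense d2.
have h1 : 0 < `|h| + 1 by rewrite ltr_wpDl.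
have r0 : 0 < (d / 2 / (`|h| + 1)) ^+ 2 by rewrite exprn_gt0// divr_gt0.
near=> e; set w := regularized _ _ _ _.
have e0 : 0 < e by near: e; exact: nbhs_right_gt.
have er : Num.sqrt e <= d / 2 / (`|h| + 1).
  have q0 : 0 <= d / 2 / (`|h| + 1) by rewrite divr_ge0 ?(ltW h1) ?(ltW d2).
  rewrite -[leRHS](ger0_norm q0) -sqrtr_sqr ler_wsqrtr//.
  by near: e; exact: nbhs_right_le.
have E := bias_eq (regularizedP (A y) e0); rewrite -/w in E.
pose v := regularized dot A e h.
have vE : normal_op e v = As h := regularizedP h e0.
(* y - w - e v = T_e^-1 (e (y - A^* h)), and e T_e^-1 is a contraction. *)
have b1 : `|y - w - e *: v| <= d / 2.
  apply: le_trans hd; rewrite -(ler_pM2l e0).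
  apply: le_trans (normal_op_expand _ e0) _.
  have -> : normal_op e (y - w - e *: v) = e *: (y - As h).
    by rewrite normal_opB normal_opZ E vE scalerBr.
  by rewrite normrZ gtr0_norm.
have b2 : `|e *: v| <= d / 2.
  rewrite normrZ gtr0_norm// -(sqr_sqrtr (ltW e0)) expr2 -mulrA.
  have := normal_eq_norm e0 (regularizedP h e0); rewrite -/v => vh.
  apply: le_trans (ler_wpM2l (sqrtr_ge0 e) vh) _.
  apply: le_trans (ler_wpM2r (normr_ge0 h) er) _.
  by rewrite mulrAC ler_pdivrMr// ler_wpM2l ?(ltW d2)// lerDl.
rewrite -[y - w](subrK (e *: v)).
by apply: le_trans (ler_normD _ _) _; lra.
Unshelve. all: by end_near. Qed.
End Bias.

End Tikhonov.

(** * Calculus of functions of one real variable with values in H *)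

Section Calculus.
Context {R : realType}.

(** Rewrites the difference quotient in direction 1, where h *: 1 is h. *)
Lemma is_derive1P (V : normedModType R) (f : R -> V) (t : R) (d : V) :
  is_derive t 1 f d <-> h^-1 *: (f (h + t) - f t) @[h --> 0^'] --> d.
Proof.
have E : (fun h : R => h^-1 *: ((f \o shift t) (h *: 1) - f t)) =
    (fun h => h^-1 *: (f (h + t) - f t)).
  by apply/funext => h /=; rewrite [h%:A]mulr1.
split=> [[df <-]|cv].
  by move: df; rewrite /derivable /derive E.
split; first by rewrite /derivable E; apply/cvg_ex; exists d.
by rewrite /derive E; exact: cvg_lim.
Qed.

Lemma is_derive1_continuous (V : normedModType R) (f : R -> V) (t : R) (d : V) :
  is_derive t 1 f d -> {for t, continuous f}.
Proof.
by move=> [df _]; apply: differentiable_continuous; apply/derivable1_diffP.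
Qed.

Lemma continuous_primitive (f : R -> R) (a : R) : continuous f ->
  exists F : R -> R, F 0 = 0 /\ forall x, a < x -> is_derive x 1 F (f x).
Proof.
move=> cf; pose F x := \int[lebesgue_measure]_(t in `[a, x]) f t.
exists (F - cst (F 0)); split; first by rewrite !fctE subrr.
move=> x ax; rewrite -[f x]subr0; apply: is_deriveB.
have xu : x < x + 1 by rewrite ltrDl.
have fi : lebesgue_measure.-integrable `[a, x + 1] (EFin \o f).
  apply: continuous_compact_integrable; first exact: segment_compact.
  exact: continuous_subspaceT.
have [dF F'] := continuous_FTC1_closed xu fi ax (cf x).
by split=> //; rewrite -derive1E.
Qed.

(** The endpoints are taken in any order, since difference quotients at a
    point use increments of both signs. *)
Lemma increment_bound (f df : R -> R) (m K a b : R) :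
  (forall x, Num.min a b <= x <= Num.max a b -> is_derive x 1 f (df x)) ->
  (forall x, Num.min a b <= x <= Num.max a b -> `|df x - m| <= K) ->
  `|f b - f a - m * (b - a)| <= K * `|b - a|.
Proof.
wlog ab : a b / a <= b => [hw|].
  case/orP: (le_total a b) => [/hw//|ba]; rewrite minC maxC => dP dK.
  have := hw b a ba dP dK.
  suff -> : f b - f a - m * (b - a) = - (f a - f b - m * (a - b)).
    by rewrite normrN (distrC b).
  by ring.
rewrite (min_idPl ab) (max_idPr ab) => dP dK.
have [||c cab ->] := MVT_segment (f := f) (df := df) ab.
- by move=> x; rewrite in_itv/= => /andP[/ltW ax /ltW xb]; apply: dP; rewrite ax.
- apply: derivable_within_continuous => x; rewrite in_itv/= => xab.
  by have [] := dP x xab.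
rewrite -mulrBl normrM ler_wpM2r//; apply: dK; move: cab; rewrite in_itv.
by [].
Qed.

End Calculus.

Section HilbertCalculus.
Context {R : realType} {H : completeNormedModType R} (dot : {dot H for idfun}).
Context (dot_norm : forall x : H, dot x x = `|x| ^+ 2).

Lemma is_derive_dotr (z : R -> H) (t : R) (dz c : H) : is_derive t 1 z dz ->
  is_derive t 1 (fun s => dot (z s) c) (dot dz c).
Proof.
move=> /is_derive1P zP; apply/is_derive1P.
rewrite (_ : (fun h => _) = (fun h => dot (h^-1 *: (z (h + t) - z t)) c)).
  exact: cvg_dotr.
by apply/funext => h; rewrite !dotE.
Qed.

Lemma is_derive_scale (k : R -> R) (z : R -> H) (t dk : R) (dz : H) :
  is_derive t 1 k dk -> is_derive t 1 z dz ->
  is_derive t 1 (fun s => k s *: z s) (dk *: z t + k t *: dz).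
Proof.
move=> dkP dzP; have ck := is_derive1_continuous dkP.
move/is_derive1P : dkP => dkP; move/is_derive1P : dzP => dzP; apply/is_derive1P.
rewrite (_ : (fun h => _) = (fun h => (h^-1 * (k (h + t) - k t)) *: z t +
  k (h + t) *: (h^-1 *: (z (h + t) - z t)))); last first.
  apply/funext => h; rewrite [in RHS]scalerA (mulrC (k _)) -!scalerA -scalerDr.
  by congr (_ *: _); rewrite scalerBl scalerBr [RHS]addrC subrKA.
apply: cvgD; apply: cvgZ => //; first exact: cvg_cst.
have : k (h + t) @[h --> 0] --> k t.
  apply: (@cvg_comp _ _ _ (fun h => h + t) k _ (nbhs t)); last exact: ck.
  suff : h + t @[h --> (0 : R)] --> t by [].
  by rewrite -[X in _ --> X]add0r; apply: cvgD; [exact: cvg_id|exact: cvg_cst].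
by apply: cvg_trans; apply: cvg_app; exact: cvg_within.
Qed.

(** Weak integration: for each vector c let F c be the primitive of
    <g, c> vanishing at 0.  Primitives being unique, F c x is linear in c, and
    it is bounded by (max |g|) |x| |c|, so Riesz yields G x with
    F c x = <c, G x>.  Testing the difference quotient of G against
    c = v, where v is its own distance to g x, bounds |v|. *)
Lemma hilbert_primitive (g : R -> H) (a : R) : a < 0 -> continuous g ->
  exists G : R -> H, G 0 = 0 /\ forall x, a < x -> is_derive x 1 G (g x).
Proof.
move=> a0 cg.
have cgd c : continuous (fun x => dot (g x) c).
  by move=> x; apply: cvg_dotr => //; exact: cg.
have /choice[F FP] c := continuous_primitive a (cgd c).
have dF c x : a < x -> is_derive x 1 (F c) (dot (g x) c) := (FP c).2 x.
have dFB b c c' x : a < x ->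
    is_derive x 1 (fun s => F (b *: c + c') s - (b * F c s + F c' s)) 0.
  move=> ax; rewrite -(subrr (dot (g x) (b *: c + c'))).
  apply: is_deriveB; first exact: dF.
  rewrite [X in is_derive _ _ _ X](_ : _ = b *: dot (g x) c + dot (g x) c').
    by apply: is_deriveD; [apply: is_deriveZ|]; exact: dF.
  by rewrite !dotE.
have /choice[G GP] x : exists Gx, a < x -> forall c, F c x = dot c Gx.
  have [ax|] := ltP a x; last by exists 0.
  have [m mab mP] := EVT_max (f := fun s => `|g s|)
    (le_trans (ltW a0) (normr_ge0 x))
    (continuous_subspaceT (fun s => cvg_norm (cg s))).
  have bet s : Num.min 0 x <= s <= Num.max 0 x -> a < s /\ s <= `|x|.
    move=> /andP[s1 s2]; split; first by rewrite (lt_le_trans _ s1)// lt_min a0.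
    by rewrite (le_trans s2)// ge_max normr_ge0 ler_norm.
  have [||Gx GxP] := riesz dot_norm (l := F ^~ x) (M := `|g m| * `|x|).
  - move=> b c c'.
    have := @increment_bound R _ (fun=> 0) 0 0 0 x
      (fun s sx => dFB b c c' s (bet s sx).1).
    rewrite subrr normr0 => /(_ (fun _ _ => lexx 0)).
    by rewrite !(FP _).1 !mul0r !mulr0 !addr0 !subr0 normr_le0 subr_eq0 => /eqP.
  - move=> c.
    have := @increment_bound R (F c) (fun s => dot (g s) c) 0 (`|g m| * `|c|) 0 x.
    rewrite (FP c).1 mul0r !subr0 mulrAC; apply.
    + by move=> s /bet[? _]; exact: dF.
    + move=> s /bet[/ltW s1 s2]; rewrite subr0.
      apply: le_trans (cauchy_schwarz dot_norm _ _) _; rewrite ler_wpM2r//.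
      by apply: mP; rewrite in_itv/= s1.
  by exists Gx.
exists G; split.
  by apply: (dot_sep dot_norm) => c; rewrite dot0l (dotC dot) -GP// (FP c).1.
move=> x ax; apply/is_derive1P/cvgrPdist_le => d d0.
have [r /= r0 rP] := (cvgrPdist_le _ _).1 (cg x) _ d0.
near=> h.
have h0 : h != 0 by near: h; exact: nbhs_dnbhs_neq.
have hr : `|h| < r.
  near: h; apply: dnbhs0_lt => //.
(* Keeps the segment between x and h + x inside the domain of F. *)
have hx : `|h| < x - a.
  near: h; apply: dnbhs0_lt; rewrite subr_gt0//.
pose v := g x - h^-1 *: (G (h + x) - G x); rewrite -/v.
have hv : h *: v = h *: g x - (G (h + x) - G x).
  by rewrite scalerBr scalerA divff// scale1r.
clearbody v.
have bet s : Num.min x (h + x) <= s <= Num.max x (h + x) -> `|x - s| <= `|h|.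
  move=> /andP[]; rewrite ge_min le_max => /orP s1 /orP s2.
  by rewrite ler_norml; case: (ger0P h) => ?; apply/andP; split; lra.
have axh s : `|x - s| <= `|h| -> a < s.
  by move=> sh; have := ler_norm (x - s); lra.
have : `|F v (h + x) - F v x - dot (g x) v * (h + x - x)| <=
    d * `|v| * `|h + x - x|.
  apply: (@increment_bound R (F v) (fun s => dot (g s) v)) => s /bet sh.
    by apply: dF; exact: axh.
  rewrite -dotNl -dotDl; apply: le_trans (cauchy_schwarz dot_norm _ _) _.
  rewrite ler_wpM2r// distrC; apply: rP => /=.
  exact: le_lt_trans hr.
rewrite addrK !GP//; last first.
  by apply: axh; rewrite opprD addrC subrK normrN.
rewrite (dotC dot (g x)).
have -> : dot v (G (h + x)) - dot v (G x) - dot v (g x) * h = - (h * `|v| ^+ 2).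
  by rewrite -dot_norm -dotZr hv !dotE; ring.
rewrite normrN normrM [X in _ * X <= _]ger0_norm ?exprn_ge0// => vd.
have [->|v0] := eqVneq v 0; first by rewrite normr0 ltW.
have v1 : 0 < `|v| by rewrite normr_gt0.
have h1 : 0 < `|h| by rewrite normr_gt0.
by rewrite -(ler_pM2r v1) -(ler_pM2l h1) -expr2 (le_trans vd)// mulrC.
Unshelve. all: by end_near. Qed.

End HilbertCalculus.

(** Replaces a function on a half-line by one on the whole line, so that
    differential equations can be solved in a neighbourhood of the endpoint. *)
Lemma continuous_clip (R : realType) (V : topologicalType) (f : R -> V) (a : R) :
  {within `[a, +oo[, continuous f} -> continuous (fun t => f (Num.max t a)).
Proof.
move=> /subspace_continuousP cf x.
have ax : `[a, +oo[%classic (Num.max x a).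
  by rewrite /= in_itv/= andbT le_max lexx orbT.
apply: (@cvg_comp _ _ _ (fun t => Num.max t a) f _
  (within `[a, +oo[ (nbhs (Num.max x a)))); last exact: cf.
have cm : Num.max t a @[t --> x] --> Num.max x a.
  by apply: (continuous_max (f := id) (g := cst a)); [exact: cvg_id|exact: cvg_cst].
move=> U /cm; apply: (@filterS _ (nbhs x)) => t; apply.
by rewrite /= in_itv/= andbT le_max lexx orbT.
Qed.

(** * The equation u' = - u + w *)

Section DampedEquation.
Context {R : realType} {H : completeNormedModType R} (dot : {dot H for idfun}).
Context (dot_norm : forall x : H, dot x x = `|x| ^+ 2).

(** Weaker than being a global solution: the one-sided derivative at 0 is
    replaced by continuity there, which is what the estimates use. *)
Definition damped (w u : R -> H) : Prop :=
  (forall b, 0 < b -> {within `[0, b], continuous u}) /\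
  forall t : R, 0 < t -> is_derive t 1 u (- u t + w t).

(** A constant is a solution with itself as right-hand side, so that
    [damped_dist] also measures the distance to a limit point. *)
Lemma damped_cst y : damped (cst y) (cst y).
Proof.
split=> [b _|t _]; first by apply: continuous_subspaceT => x; exact: cvg_cst.
by rewrite addNr; exact: is_derive_cst.
Qed.

(** With c = z b, the scalar function exp t (<z t, c> - K |c|) is
    nonincreasing; compare its values at a and b. *)
Lemma decay_bound (z p : R -> H) (a b K : R) : a <= b -> 0 <= K ->
  {within `[a, b], continuous z} ->
  (forall t, a < t < b -> is_derive t 1 z (- z t + p t)) ->
  (forall t, a < t < b -> `|p t| <= K) ->
  `|z b| <= K + expR (a - b) * `|z a|.
Proof.
move=> ab K0 cz dz pK; set c := z b.
have [->|c0] := eqVneq c 0.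
  by rewrite normr0 addr_ge0// mulr_ge0 ?expR_ge0.
have c1 : 0 < `|c| by rewrite normr_gt0.
pose phi t := expR t * (dot (z t) c - K * `|c|).
have dphi t : a < t < b ->
    is_derive t 1 phi (expR t * (dot (p t) c - K * `|c|)).
  move=> tab; apply: is_derive_eq; first apply: is_deriveM.
    apply: is_deriveB; first by apply: is_derive_dotr => //; exact: dz.
  rewrite subr0 !dotE /GRing.scale/=; ring.
have : phi b <= phi a.
  apply: (@ler0_derive1_le_cc _ phi a b); rewrite ?in_itv/= ?lexx ?ab//.
  - by move=> t; rewrite in_itv/= => /dphi[].
  - move=> t; rewrite in_itv/= => tab; rewrite derive1E.
    have [_ ->] := dphi t tab; rewrite pmulr_rle0 ?expR_gt0// subr_le0.
    by apply: le_trans (dot_le dot_norm _ _) _; rewrite ler_wpM2r// pK.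
  - move=> t; apply: cvgM.
      by apply: (continuous_subspaceT (f := expR)); exact: continuous_expR.
    by apply: cvgB; [apply: cvg_dotr => //; exact: cz|exact: cvg_cst].
rewrite /phi -/c dot_norm => phiab.
have h : expR b * (`|c| * `|c|) <= expR a * (`|z a| * `|c|) + expR b * (K * `|c|).
  have := ler_wpM2l (expR_ge0 a) (dot_le dot_norm (z a) c).
  have : 0 <= expR a * (K * `|c|) by rewrite !mulr_ge0// expR_ge0.
  rewrite expr2 in phiab; move: phiab; rewrite !mulrBr; lra.
rewrite expRB -(ler_pM2r c1) -(ler_pM2l (expR_gt0 b)); apply: le_trans h _.
rewrite le_eqVlt; apply/orP; left; apply/eqP.
by field; rewrite gt_eqF// expR_gt0.
Qed.

Lemma damped_dist (w w' u v : R -> H) (a t K : R) : damped w u -> damped w' v ->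
  0 <= a -> a <= t -> 0 <= K -> (forall s, a < s < t -> `|w s - w' s| <= K) ->
  `|u t - v t| <= K + expR (a - t) * `|u a - v a|.
Proof.
move=> [cu du] [cv dv] a0 at_ K0 wK.
have [t0|t0] := eqVneq t 0.
  have -> : a = t by apply/eqP; rewrite eq_le at_ t0.
  by rewrite subrr expR0 mul1r lerDr.
have {}t0 : 0 < t by rewrite lt_def t0 (le_trans a0).
apply: (@decay_bound (u \- v) (w \- w')) => //.
- apply: (@continuous_subspaceW _ _ _ `[0, t]).
    by apply: subset_itvr; rewrite bnd_simp.
  by move=> x; apply: cvgB; [exact: cu|exact: cv].
- move=> s /andP[sa _]; have s0 := le_lt_trans a0 sa.
  apply: is_derive_eq; first by apply: is_deriveB; [exact: du|exact: dv].
  by rewrite opprD addrACA -opprD.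
Qed.

(** Start from a time a after which w stays within d / 2 of y; the memory of
    u a is then damped exponentially. *)
Lemma damped_cvg (w u : R -> H) (y : H) : damped w u ->
  w t @[t --> +oo] --> y -> u t @[t --> +oo] --> y.
Proof.
move=> du wy; apply/cvgrPdist_le => d d0.
have d2 : 0 < d / 2 by rewrite divr_gt0.
have [T [_ TP]] := (cvgrPdist_le _ _).1 wy _ d2.
pose a := Num.max T 0.
have a0 : 0 <= a by rewrite le_max lexx orbT.
have cv : expR (a - t) * `|u a - y| @[t --> +oo] --> (0 : R).
  rewrite -(mul0r `|u a - y|); apply: cvgM; last exact: cvg_cst.
  under eq_fun do rewrite expRD.
  rewrite -(mulr0 (expR a)); apply: cvgM; first exact: cvg_cst.
  exact: cvgr_expR.
near=> t; rewrite distrC.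
have at_ : a <= t by near: t; apply: nbhs_pinfty_ge; exact: num_real.
apply: le_trans (damped_dist du (damped_cst y) a0 at_ (ltW d2) _) _.
  move=> s /andP[sa _]; rewrite distrC; apply: TP.
  by rewrite (le_lt_trans _ sa)// le_max lexx.
rewrite [leRHS]splitr lerD2l.
near: t; exact: (cvgr_le _ cv _ d2).
Unshelve. all: by end_near. Qed.

(** Variation of constants: u t = exp(-t) (u0 + int_0^t exp(s) g(s) ds). *)
Lemma damped_solution (g : R -> H) (u0 : H) : continuous g ->
  exists u, u 0 = u0 /\ forall t : R, 0 <= t -> is_derive t 1 u (- u t + g t).
Proof.
move=> cg.
have ceg : continuous (fun t => expR t *: g t).
  by move=> t; apply: cvgZ; [exact: continuous_expR|exact: cg].
have [G [G0 GP]] := hilbert_primitive dot_norm (ltrN10 R) ceg.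
exists (fun t => expR (- t) *: (u0 + G t)); split.
  by rewrite oppr0 expR0 scale1r G0 addr0.
move=> t t0; apply: is_derive_eq.
  have dexp : is_derive t 1 (fun s => expR (- s)) (expR (- t) * -1).
    exact: (@is_derive1_comp _ expR -%R).
  apply: is_derive_scale.
  by apply: is_deriveD; apply: GP; apply: lt_le_trans t0.
rewrite mulrN1 scaleNr add0r; congr (_ + _).
by rewrite scalerA -expRD addNr expR0 scale1r.
Qed.

End DampedEquation.

Lemma continuous_hits (R : realType) (phi : R -> R) (c : R) : continuous phi ->
  c <= phi 0 -> (\forall t \near +oo, phi t <= c) ->
  exists t, 0 <= t /\ phi t = c.
Proof.
move=> cphi c0 phic.
near (pinfty_nbhs R) => T.
have T0 : 0 <= T by near: T; apply: nbhs_pinfty_ge; exact: num_real.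
have phiT : phi T <= c by near: T.
have btw : Num.min (phi 0) (phi T) <= c <= Num.max (phi 0) (phi T).
  by rewrite ge_min phiT orbT le_max c0.
have [t] := IVT T0 (continuous_subspaceT cphi) btw.
by rewrite in_itv/= => /andP[t0 _] <-; exists t.
Unshelve. all: by end_near. Qed.

(** * Dynamical regularization and stopping times *)

Section Regularization.
Context {R : realType} {H : completeNormedModType R} (dot : {dot H for idfun}).
Context (dot_norm : forall x : H, dot x x = `|x| ^+ 2).
Context (A : {linear H -> H}) (M : R) (M0 : 0 <= M).
Context (A_le : forall x, `|A x| <= M * `|x|).
Context (eps : R -> R) (eps_gt0 : forall t : R, 0 <= t -> 0 < eps t).
Context (eps_cont : {within `[0, +oo[%classic, continuous eps}).
Context (eps_decr : forall s t : R, 0 <= s -> s <= t -> eps t <= eps s).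
Context (eps_lim : eps t @[t --> +oo] --> 0).

Notation w g t := (regularized dot A (eps t) g).

Lemma bounded_cvg (T : Type) (F : set_system T) (FF : Filter F) (x : T -> H) l :
  x @ F --> l -> A (x t) @[t --> F] --> A l.
Proof.
move=> xl; apply/cvgrPdist_le => d d0.
have M1 : 0 < M + 1 by rewrite ltr_wpDl.
near=> t; rewrite -linearB; apply: le_trans (A_le _) _.
have : `|l - x t| <= d / (M + 1).
  by near: t; apply: (cvgrPdist_le _ _).1 xl _ _; rewrite divr_gt0.
rewrite ler_pdivlMr// mulrDr mulr1 mulrC => h.
by apply: le_trans h; rewrite lerDl.
Unshelve. all: by end_near. Qed.

Lemma regularized_clip_continuous (g : H) :
  continuous (fun t : R => w g (Num.max t 0)).
Proof.
move=> t.
apply: (@cvg_comp _ _ _ (fun t => eps (Num.max t 0))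
  (fun e => regularized dot A e g) _ (nbhs (eps (Num.max t 0)))).
  exact: continuous_clip.
by apply: regularized_continuous => //; apply: eps_gt0; rewrite le_max lexx orbT.
Qed.

Lemma global_solution_damped g u0 u : global_solution dot A eps g u0 u ->
  damped (fun t => w g t) u.
Proof.
move=> [_ u'0 u'E]; split=> // b b0.
apply/continuous_within_itvP => //; split.
- by move=> t; rewrite in_itv/= => /andP[t0 _]; exact: is_derive1_continuous (u'E t t0).
- have : (h : R) *: (h^-1 *: (u h - u 0)) + u 0 @[h --> 0^'+] --> u 0.
    rewrite -[X in _ --> X]add0r -[X in X + _](scale0r (- u 0 + w g 0)).
    apply: cvgD; last exact: cvg_cst.
    apply: cvgZ; last exact: u'0.
    exact: cvg_at_right_filter.
  apply: cvg_trans; apply: near_eq_cvg; near=> h.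
  by rewrite scalerA divff ?scale1r ?subrK//; near: h; exact: nbhs_right_neq.
- by apply: cvg_at_left_filter; exact: is_derive1_continuous (u'E b b0).
Unshelve. all: by end_near. Qed.

Lemma global_solution_exists (g u0 : H) :
  exists u, unique_global_solution dot A eps g u0 u.
Proof.
have [u [u00 uE]] := damped_solution dot_norm u0 (@regularized_clip_continuous g).
have us : global_solution dot A eps g u0 u.
  split=> //.
  - have := (is_derive1P _ _ _).1 (uE 0 (lexx 0)); rewrite maxxx => /cvg_dnbhs_at_right.
    by under eq_fun do rewrite addr0.
  - by move=> t t0; have := uE t (ltW t0); rewrite (max_idPl (ltW t0)).
exists u; split=> // v vs t t0; apply/eqP; rewrite -subr_eq0 -normr_le0.
have := damped_dist dot_norm (global_solution_damped vs)
  (global_solution_damped us) (lexx 0) t0 (lexx 0).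
have [-> _ _] := vs; rewrite u00 subrr normr0 mulr0 addr0; apply => s _.
by rewrite subrr normr0.
Qed.

Lemma eps_cvg0 : eps t @[t --> +oo] --> 0^'+.
Proof.
move=> U /= [r /= r0 rU].
suff : \forall t \near +oo, U (eps t) by [].
near=> t; apply: rU => /=.
  by near: t; exact: (cvgrPdist_lt _ _).1 eps_lim _ r0.
by apply: eps_gt0; near: t; apply: nbhs_pinfty_ge; exact: num_real.
Unshelve. all: by end_near. Qed.

Lemma a_priori_time_exists b : 0 < b ->
  \forall d \near 0^'+, exists t, a_priori_time eps b d t.
Proof.
move=> b0; near=> d.
pose phi t := 2 * Num.sqrt (eps (Num.max t 0)).
have [|||t [t0 tE]] := @continuous_hits R phi (d `^ b).
- move=> t; apply: cvgM; first exact: cvg_cst.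
  apply: (@cvg_comp _ _ _ (fun t => eps (Num.max t 0)) Num.sqrt _
    (nbhs (eps (Num.max t 0)))); last exact: sqrt_continuous.
  exact: continuous_clip.
- rewrite /phi maxxx; near: d; apply: (cvgr_le _ (powR_cvg0 b0)).
  by rewrite mulr_gt0// sqrtr_gt0 eps_gt0.
- have db : 0 < d `^ b / 2.
    by rewrite divr_gt0// powR_gt0//; near: d; exact: nbhs_right_gt.
  near=> t; rewrite /phi mulrC -ler_pdivlMr// (max_idPl _); last first.
    by near: t; apply: nbhs_pinfty_ge; exact: num_real.
  rewrite -[leRHS](ger0_norm (ltW db)) -sqrtr_sqr ler_wsqrtr//.
  near: t; apply: (cvgr_le _ eps_lim); exact: exprn_gt0.
by exists t; split => //; rewrite -tE /phi (max_idPl t0).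
Unshelve. all: by end_near. Qed.

(** As eps is positive and nonincreasing, it can only get small at late
    times. *)
Lemma eps_time_cvgy (td : R -> R) : (\forall d \near 0^'+, 0 <= td d) ->
  eps (td d) @[d --> 0^'+] --> 0 -> td d @[d --> 0^'+] --> +oo.
Proof.
move=> td0 etd; apply/cvgryPge => T.
have T0 : 0 <= Num.max T 0 by rewrite le_max lexx orbT.
near=> d; rewrite leNgt; apply/negP => tdT.
have : eps (td d) < eps (Num.max T 0).
  by near: d; apply: (cvgr_lt _ etd); exact: eps_gt0.
rewrite ltNge => /negP; apply; apply: eps_decr; first by near: d.
by rewrite le_max (ltW tdT).
Unshelve. all: by end_near. Qed.

Section Data.
Context (y : H) (y_perp : forall z, A z = 0 -> dot y z = 0).
Notation f := (A y).

Lemma regularized_time_cvg : w f t @[t --> +oo] --> y.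
Proof.
apply: (@cvg_comp _ _ _ eps (fun e => regularized dot A e f) _ 0^'+).
  exact: eps_cvg0.
exact: (regularized_cvg dot_norm A_le y_perp).
Qed.

Lemma solution_cvg u0 u : global_solution dot A eps f u0 u ->
  u t @[t --> +oo] --> y.
Proof.
move=> /global_solution_damped us.
by apply: (damped_cvg dot_norm us); exact: regularized_time_cvg.
Qed.

Context (fd : R -> H) (fdP : forall d : R, 0 < d -> `|f - fd d| <= d).

(** The difference of the two residuals is the residual for the data
    fd d - f, hence at most |fd d - f|. *)
Lemma noise_residual d e : 0 < d -> 0 < e ->
  `|A (regularized dot A e (fd d)) - fd d| <=
  `|A (regularized dot A e f) - f| + d.
Proof.
move=> d0 e0.
have := normal_eq_residual dot_norm A_le e0 (normal_eqB dot_norm A_le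
  (regularizedP dot_norm A_le (fd d) e0) (regularizedP dot_norm A_le f e0)).
set v := regularized _ _ _ f; set vd := regularized _ _ _ _ => h.
have -> : A vd - fd d = (A v - f) + (A (vd - v) - (fd d - f)).
  rewrite linearB/=; set a := A vd; set b := A v.
  suff -> : a - b - (fd d - f) = (a - fd d) - (b - f) by rewrite [RHS]addrC subrK.
  by rewrite !opprB addrACA [RHS]addrACA (addrC (- b)).
apply: le_trans (ler_normD _ _) _; rewrite lerD2l; apply: le_trans h _.
by rewrite distrC fdP.
Qed.

(** Both solutions start from u0, and up to time t their right-hand sides
    differ by at most d / sqrt (eps s) <= d / sqrt (eps t). *)
Lemma noise_solution u0 u v d t : 0 < d -> 0 <= t ->
  global_solution dot A eps f u0 u -> global_solution dot A eps (fd d) u0 v ->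
  `|v t - u t| <= d / Num.sqrt (eps t).
Proof.
move=> d0 t0 us vs.
have s0 : 0 < Num.sqrt (eps t) by rewrite sqrtr_gt0 eps_gt0.
have := damped_dist dot_norm (global_solution_damped vs)
  (global_solution_damped us) (lexx 0) t0 (K := d / Num.sqrt (eps t)).
have [-> _ _] := vs; have [-> _ _] := us.
rewrite subrr normr0 mulr0 addr0; apply; first by rewrite divr_ge0 ?ltW.
move=> s /andP[sp st]; rewrite ler_pdivlMr// mulrC.
have e0 := eps_gt0 (ltW sp).
have := normal_eq_norm dot_norm A_le e0 (normal_eqB dot_norm A_le
  (regularizedP dot_norm A_le (fd d) e0) (regularizedP dot_norm A_le f e0)).
rewrite [`|fd d - f|]distrC => /le_trans /(_ (fdP d0)); apply: le_trans.
by rewrite ler_wpM2r// ler_wsqrtr// eps_decr// ltW.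
Qed.

(** The noise contributes d / sqrt (eps (td d)), and the exact solution at
    time td d tends to y since td d tends to infinity. *)
Lemma stopping_cvg u0 (ud : R -> R -> H) (td : R -> R) :
  (forall d : R, 0 < d -> global_solution dot A eps (fd d) u0 (ud d)) ->
  (\forall d \near 0^'+, 0 <= td d) ->
  eps (td d) @[d --> 0^'+] --> 0 ->
  d / Num.sqrt (eps (td d)) @[d --> 0^'+] --> 0 ->
  `|ud d (td d) - y| @[d --> 0^'+] --> 0.
Proof.
move=> uds td0 etd dtd.
have [u [us _]] := global_solution_exists f u0.
have utd : u (td d) @[d --> 0^'+] --> y.
  apply: (@cvg_comp _ _ _ td u _ (pinfty_nbhs R)); last exact: solution_cvg us.
  exact: eps_time_cvgy.
have cv : d / Num.sqrt (eps (td d)) + `|u (td d) - y| @[d --> 0^'+] --> 0.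
  rewrite -[X in _ --> X]addr0; apply: cvgD => //.
  rewrite -[X in _ --> X](normr0 H) -(subrr y).
  by apply: cvg_norm; apply: cvgB => //; exact: cvg_cst.
apply: (squeeze_cvgr _ (cvg_cst 0) cv); near=> d.
have d0 : 0 < d by near: d; exact: nbhs_right_gt.
rewrite normr_ge0/=; apply: le_trans (ler_distD (u (td d)) _ _) _.
rewrite lerD2r; apply: noise_solution => //; last exact: uds.
by near: d.
Unshelve. all: by end_near. Qed.

Lemma a_priori_stopping b (td : R -> R) : 0 < b -> b < 1 ->
  (\forall d \near 0^'+, a_priori_time eps b d (td d)) ->
  [/\ \forall d \near 0^'+, 0 <= td d, eps (td d) @[d --> 0^'+] --> 0 &
      d / Num.sqrt (eps (td d)) @[d --> 0^'+] --> 0].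
Proof.
move=> b0 b1 tdP; split.
- by apply: filterS tdP => d [].
- have : (d `^ b / 2) * (d `^ b / 2) @[d --> 0^'+] --> ((0 : R) / 2) * (0 / 2).
    by apply: cvgM; (apply: cvgM; [exact: powR_cvg0|exact: cvg_cst]).
  rewrite !mul0r; apply: cvg_trans; apply: near_eq_cvg.
  apply: filterS tdP => d [t0 <-].
  by rewrite -expr2 [2 * _]mulrC mulfK// sqr_sqrtr// ltW// eps_gt0.
- have : 2 * d `^ (1 - b) @[d --> 0^'+] --> (2 * 0 : R).
    by apply: cvgM; [exact: cvg_cst|apply: powR_cvg0; rewrite subr_gt0].
  rewrite mulr0; apply: cvg_trans; apply: near_eq_cvg; near=> d.
  have d0 : 0 < d by near: d; exact: nbhs_right_gt.
  have [t0 tE] : a_priori_time eps b d (td d) by near: d.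
  have s0 : 0 < Num.sqrt (eps (td d)) by rewrite sqrtr_gt0 eps_gt0.
  rewrite powRB ?(gt_eqF d0) ?implybT// powRr1 ?(ltW d0)// -tE.
  by field; rewrite gt_eqF.
Unshelve. all: by end_near. Qed.

(** If eps (td d) stayed above some r, then |fd d| would be O(d) by
    [normal_eq_residual_ge], against fd d -> f <> 0.  The second limit follows
    from (C - 1) d <= |A w - f| <= sqrt (eps (td d) |y| |y - w|). *)
Lemma discrepancy_stopping C (td : R -> R) : 1 < C -> f <> 0 ->
  (\forall d \near 0^'+, discrepancy_time dot A eps C (fd d) d (td d)) ->
  [/\ \forall d \near 0^'+, 0 <= td d, eps (td d) @[d --> 0^'+] --> 0 &
      d / Num.sqrt (eps (td d)) @[d --> 0^'+] --> 0].
Proof.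
move=> C1 f0 tdP.
have C0 : 0 < C - 1 by rewrite subr_gt0.
have td0 : \forall d \near 0^'+, 0 <= td d by apply: filterS tdP => d [].
have etd : eps (td d) @[d --> 0^'+] --> 0.
  apply/cvgrPdist_le => r r0.
  have fpos : 0 < `|f| by rewrite normr_gt0; exact/eqP.
  (* |f| <= d + |fd d| <= k d as soon as eps (td d) >= r. *)
  pose k := 1 + C * (1 + M ^+ 2 / r).
  have k0 : 0 < k.
    rewrite ltr_wpDr// mulr_ge0 ?(ltW (lt_trans ltr01 C1))//.
    by rewrite addr_ge0// divr_ge0 ?exprn_ge0// ltW.
  near=> d.
  have d0 : 0 < d by near: d; exact: nbhs_right_gt.
  have [t0 tE] : discrepancy_time dot A eps C (fd d) d (td d) by near: d.
  have e0 := eps_gt0 t0.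
  rewrite sub0r normrN gtr0_norm// leNgt; apply/negP => re.
  have dk : d < `|f| / k by near: d; apply: nbhs_right_lt; exact: divr_gt0.
  have := normal_eq_residual_ge dot_norm M0 A_le e0
    (regularizedP dot_norm A_le (fd d) e0).
  rewrite tE => fdle.
  have : (1 + M ^+ 2 / eps (td d)) * (C * d) <= (1 + M ^+ 2 / r) * (C * d).
    apply: ler_wpM2r; first by rewrite mulr_ge0 ?(ltW d0)// (ltW (lt_trans ltr01 C1)).
    by rewrite lerD2l ler_wpM2l ?exprn_ge0// lef_pV2 ?posrE// ltW.
  have : `|f| <= d + `|fd d|.
    rewrite -[X in `|X| <= _](subrK (fd d)); apply: le_trans (ler_normD _ _) _.
    by rewrite lerD2r fdP.
  move: dk; rewrite ltr_pdivlMr// /k; nra.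
split=> //.
have wtd : w f (td d) @[d --> 0^'+] --> y.
  apply: (@cvg_comp _ _ _ td (fun t => w f t) _ (pinfty_nbhs R)).
    exact: eps_time_cvgy.
  exact: regularized_time_cvg.
have cv : Num.sqrt (`|y| * `|y - w f (td d)|) / (C - 1) @[d --> 0^'+] --> 0.
  have c1 : `|y| * `|y - w f (td d)| @[d --> 0^'+] --> `|y| * `|y - y|.
    apply: cvgM; first exact: cvg_cst.
    by apply: cvg_norm; apply: cvgB => //; exact: cvg_cst.
  have c2 : Num.sqrt (`|y| * `|y - w f (td d)|) @[d --> 0^'+] -->
      Num.sqrt (`|y| * `|y - y|).
    by apply: cvg_comp c1 _; exact: sqrt_continuous.
  rewrite [0 in X in _ --> X](_ : _ = Num.sqrt (`|y| * `|y - y|) / (C - 1)).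
    by apply: cvgM => //; exact: cvg_cst.
  by rewrite subrr normr0 mulr0 sqrtr0 mul0r.
apply: (squeeze_cvgr _ (cvg_cst 0) cv); near=> d.
have d0 : 0 < d by near: d; exact: nbhs_right_gt.
have [t0 tE] : discrepancy_time dot A eps C (fd d) d (td d) by near: d.
have e0 := eps_gt0 t0.
have s0 : 0 < Num.sqrt (eps (td d)) by rewrite sqrtr_gt0.
rewrite divr_ge0 ?(ltW d0) ?(ltW s0)//= ler_pdivlMr// mulrAC ler_pdivrMr//.
have := noise_residual d0 e0; rewrite tE => Cd.
have := bias_residual dot_norm A_le (regularizedP dot_norm A_le f e0) e0.
set r := A _ - A y in Cd *; set q := `|y| * _ => h.
have q0 : 0 <= q by rewrite mulr_ge0.
have : `|r| <= Num.sqrt (eps (td d)) * Num.sqrt q.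
  rewrite -sqrtrM ?(ltW e0)// -[leLHS](ger0_norm (normr_ge0 r)) -sqrtr_sqr.
  exact: ler_wsqrtr.
rewrite [X in _ -> _ <= X]mulrC; apply: le_trans; lra.
Unshelve. all: by end_near. Qed.

(** For f = 0 the residual is at most |fd d| <= d, below C d. *)
Lemma discrepancy_time_data0 C d t : 1 < C -> 0 < d -> f = 0 ->
  ~ discrepancy_time dot A eps C (fd d) d t.
Proof.
move=> C1 d0 f0 [t0 tE]; have e0 := eps_gt0 t0.
have := normal_eq_residual dot_norm A_le e0 (regularizedP dot_norm A_le (fd d) e0).
have := fdP d0; rewrite tE f0 sub0r normrN; nra.
Qed.

(** The residual depends continuously on t, exceeds C d at t = 0 for small d
    and has an upper limit at most d < C d at infinity. *)
Lemma discrepancy_time_exists C : 1 < C -> f <> 0 ->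
  \forall d \near 0^'+, exists t, discrepancy_time dot A eps C (fd d) d t.
Proof.
move=> C1 f0; have C0 : 0 < C - 1 by rewrite subr_gt0.
have fpos : 0 < `|f| by rewrite normr_gt0; exact/eqP.
have e0 := eps_gt0 (lexx 0).
(* For d < |f| / k the residual at t = 0 is larger than C d. *)
pose k := 1 + C * (1 + M ^+ 2 / eps 0).
have k0 : 0 < k.
  rewrite ltr_wpDr// mulr_ge0 ?(ltW (lt_trans ltr01 C1))//.
  by rewrite addr_ge0// divr_ge0 ?exprn_ge0// ltW.
near=> d.
have d0 : 0 < d by near: d; exact: nbhs_right_gt.
have dk : d < `|f| / k by near: d; apply: nbhs_right_lt; exact: divr_gt0.
have [|||t [t0 tE]] := @continuous_hits R
  (fun t => `|A (w (fd d) (Num.max t 0)) - fd d|) (C * d).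
- move=> t; apply: cvg_norm; apply: cvgB; last exact: cvg_cst.
  by apply: bounded_cvg; exact: regularized_clip_continuous.
- rewrite maxxx.
  have := normal_eq_residual_ge dot_norm M0 A_le e0
    (regularizedP dot_norm A_le (fd d) e0).
  have : `|f| <= d + `|fd d|.
    rewrite -[X in `|X| <= _](subrK (fd d)); apply: le_trans (ler_normD _ _) _.
    by rewrite lerD2r fdP.
  have M1 : 0 < 1 + M ^+ 2 / eps 0.
    by rewrite ltr_wpDr// divr_ge0 ?exprn_ge0// ltW.
  move: dk; rewrite ltr_pdivlMr// /k => h1 h2 h3.
  rewrite -(ler_pM2l M1); apply: le_trans h3; lra.
- have Aw : A (w f t) @[t --> +oo] --> f.
    by apply: bounded_cvg; exact: regularized_time_cvg.
  have Cd : 0 < (C - 1) * d by rewrite mulr_gt0.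
  near=> t.
  have t0 : 0 <= t by near: t; apply: nbhs_pinfty_ge; exact: num_real.
  rewrite (max_idPl t0); apply: le_trans (noise_residual d0 (eps_gt0 t0)) _.
  suff : `|f - A (w f t)| <= (C - 1) * d by rewrite distrC; lra.
  by near: t; exact: (cvgrPdist_le _ _).1 Aw _ Cd.
by exists t; split=> //; rewrite -tE (max_idPl t0).
Unshelve. all: by end_near. Qed.

End Data.
End Regularization.

(** Pythagoras: any other solution is y plus a vector of the kernel. *)
Lemma orthogonal_minimal_norm (R : realType) (H : completeNormedModType R)
    (dot : {dot H for idfun}) (dot_norm : forall x : H, dot x x = `|x| ^+ 2)
    (A : {linear H -> H}) (y : H) : (forall z, A z = 0 -> dot y z = 0) ->
  minimal_norm_solution A (A y) y.
Proof.
move=> y_perp; split=> // z Az zy.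
have Azy : A (z - y) = 0 by rewrite linearB/= Az subrr.
have zy0 : 0 < `|z - y| ^+ 2 by rewrite exprn_gt0// normr_gt0 subr_eq0; exact/eqP.
rewrite -(@ltr_pXn2r _ 2%N)// ?nnegrE// -[X in _ < `|X| ^+ 2](subrK y) -!dot_norm.
have yzy := y_perp _ Azy; rewrite -dot_norm in zy0.
move: (z - y) zy0 yzy => v v0 yv.
by rewrite !(dotDl, dotDr) (dotC dot v y) yv addr0 add0r ltrDr.
Qed.

Theorem theorem3p2 (R : realType) (H : completeNormedModType R)
    (dot : {dot H for idfun}) (dot_norm : forall x : H, dot x x = `|x| ^+ 2)
    (A : {linear H -> H}) (A_bounded : bounded_operator A)
    (A_range : ~ closed (range A))
    (f y : H) (Ay : A y = f) (y_perp : forall z, A z = 0 -> dot y z = 0)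
    (eps : R -> R)
    (eps_gt0 : forall t, 0 <= t -> 0 < eps t)
    (eps_cont : {within `[0, +oo[%classic, continuous eps})
    (eps_decr : forall s t, 0 <= s -> s <= t -> eps t <= eps s)
    (eps_lim : eps t @[t --> +oo] --> 0)
    (u0 : H) :
  [/\ exists u : R -> H, unique_global_solution dot A eps f u0 u /\
        u t @[t --> +oo] --> y,
      A y = f,
      minimal_norm_solution A f y &
      forall fd : R -> H, (forall d, 0 < d -> `|f - fd d| <= d) ->
      [/\ forall d, 0 < d ->
            exists u, unique_global_solution dot A eps (fd d) u0 u,
          forall b, 0 < b -> b < 1 ->
            \forall d \near 0^'+, exists t, a_priori_time eps b d t,
          forall C, 1 < C -> f <> 0 ->
            \forall d \near 0^'+,
              exists t, discrepancy_time dot A eps C (fd d) d t &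
          forall ud : R -> R -> H,
            (forall d, 0 < d -> global_solution dot A eps (fd d) u0 (ud d)) ->
          forall td : R -> R,
            (exists b, [/\ 0 < b, b < 1 &
               \forall d \near 0^'+, a_priori_time eps b d (td d)]) \/
            (exists C, 1 < C /\
               \forall d \near 0^'+,
                 discrepancy_time dot A eps C (fd d) d (td d)) ->
          `|ud d (td d) - y| @[d --> 0^'+] --> 0]].
Proof.
have [M0 A_le0] := A_bounded.
have A_le x : `|A x| <= `|M0| * `|x|.
  by apply: le_trans (A_le0 x) _; rewrite ler_wpM2r// ler_norm.
have M_ge0 : 0 <= `|M0| := normr_ge0 M0.
subst f; split=> //.
- have [u us] := global_solution_exists dot_norm A_le eps_gt0 eps_cont (A y) u0.
  exists u; split=> //.
  exact: (solution_cvg dot_norm A_le eps_gt0 eps_lim y_perp us.1).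
- exact: (orthogonal_minimal_norm dot_norm).
move=> fd fdP; split.
- move=> d _; exact: (global_solution_exists dot_norm A_le eps_gt0 eps_cont).
- by move=> b b0 _; exact: a_priori_time_exists.
- move=> C C1 Ay0; exact: (discrepancy_time_exists dot_norm M_ge0 A_le
    eps_gt0 eps_cont eps_lim y_perp fdP C1 Ay0).
move=> ud uds td tdP.
have stop := stopping_cvg dot_norm A_le eps_gt0 eps_cont eps_decr eps_lim
  y_perp fdP uds.
case: tdP => [[b [b0 b1 tdP]]|[C [C1 tdP]]].
  by have [] := a_priori_stopping eps_gt0 b0 b1 tdP; exact: stop.
have [Ay0|/eqP Ay0] := eqVneq (A y) 0; last first.
  have [] := discrepancy_stopping dot_norm M_ge0 A_le eps_gt0 eps_decr eps_lim
    y_perp fdP C1 Ay0 tdP.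
  exact: stop.
have : \forall d \near (0 : R)^'+, False.
  near=> d; have d0 : 0 < d by near: d; exact: nbhs_right_gt.
  have dt : discrepancy_time dot A eps C (fd d) d (td d) by near: d.
  exact: (discrepancy_time_data0 dot_norm A_le eps_gt0 fdP C1 d0 Ay0 dt).
by move=> /filter_ex[].
Unshelve. all: by end_near. Qed.
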